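(* Assume that $G:\mathbb{R}^p\to\mathbb{R}^p$ is $\frac1L$-co-coercive with $L>0$, that $\mathrm{zer}(G):=\{y:Gy=0\}\ne\emptyset$, and let $y^\star\in\mathrm{zer}(G)$. Let $y_0\in\mathbb{R}^p$, $x_0=y_{-1}:=y_0$, and let $\{(x_k,y_k)\}$ be generated, for $k\ge0$, by $$\begin{cases} x_{k+1} := y_k-\gamma_k Gy_k,\\ y_{k+1} := x_{k+1}+\theta_k(x_{k+1}-x_k)+\nu_k(y_k-x_{k+1})+\kappa_k(y_{k-1}-x_k),\end{cases}\qquad(\ast)$$ where $$\theta_k:=\frac{\beta_k(1-\beta_{k-1})}{\beta_{k-1}},\qquad \nu_k:=\frac{\beta_k}{\beta_{k-1}}+1-\beta_k-\frac{\eta_k}{\gamma_k},\qquad \kappa_k:=\frac{\beta_k}{\beta_{k-1}}\left(\frac{\eta_{k-1}}{\gamma_{k-1}}-1+\beta_{k-1}\right),$$ and the formulas for $\beta_k,\eta_k,\gamma_k$ below are used for all $k\ge-1$. (i) If $\gamma_k:=\frac1L$, $\beta_k:=\frac1{k+2}$, and $\eta_k:=\frac{1-\beta_k}{L}$, then $\theta_k=\frac{k}{k+2}$, $\nu_k=\frac{k+1}{k+2}$, $\kappa_k=0$, so that $(\ast)$ reduces to $$x_{k+1}:=y_k-\tfrac1LGy_k,\qquad y_{k+1}:=x_{k+1}+\tfrac{k}{k+2}(x_{k+1}-x_k)+\tfrac{k+1}{k+2}(y_k-x_{k+1}),$$ and the following hold: $$\|Gy_k\|^2\le\frac{4L^2\|y_0-y^\star\|^2}{(k+1)(k+3)}\quad(k\ge0),\qquad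 \sum_{k=0}^\infty(k+1)(k+2)\|Gy_{k+1}-Gy_k\|^2\le2L^2\|y_0-y^\star\|^2.$$ (ii) If $\gamma_k:=\frac1L$, $\beta_k:=\frac1{k+2}$, and $\eta_k:=\frac{2(1-\beta_k)}{L}$, then $\theta_k=\frac{k}{k+2}$, $\nu_k=0$, $\kappa_k=\frac{k}{k+2}$, so that $(\ast)$ reduces to $$x_{k+1}:=y_k-\tfrac1LGy_k,\qquad y_{k+1}:=x_{k+1}+\tfrac{k}{k+2}(x_{k+1}-x_k)+\tfrac{k}{k+2}(y_{k-1}-x_k),$$ and $\|Gy_k\|\le\frac{L\|y_0-y^\star\|}{k+1}$ for all $k\ge0$.
   Context: $G$ is $\frac1L$-co-coercive if $\langle Gx-Gy,x-y\rangle\ge \frac1L\|Gx-Gy\|^2$ for all $x,y\in\mathbb{R}^p$. $\|\cdot\|$ is the Euclidean norm. *)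

(* Defs.v *)
From HB Require Import structures.
From mathcomp Require Import all_boot all_order all_algebra.
From mathcomp Require Import all_classical all_reals all_analysis.

Set Implicit Arguments.
Unset Strict Implicit.
Unset Printing Implicit Defensive.

Import Order.TTheory GRing.Theory Num.Theory.
Local Open Scope classical_set_scope.
Local Open Scope ring_scope.

(* The library's norm `|u| on 'rV[R]_p is the sup norm, and its Hermitian
   product on row vectors requires an algebraically closed field; hence the
   Euclidean structure of R^p is defined here. *)
Definition dotp (R : realType) (p : nat) (u v : 'rV[R]_p) : R :=
  \sum_(i < p) u 0 i * v 0 i.

Definition enorm (R : realType) (p : nat) (u : 'rV[R]_p) : R :=
  Num.sqrt (dotp u u).

Definition cocoercive (R : realType) (p : nat) (c : R)
    (G : 'rV[R]_p -> 'rV[R]_p) : Prop :=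
  forall x y, dotp (G x - G y) (x - y) >= c * enorm (G x - G y) ^+ 2.

Definition zer (R : realType) (p : nat) (G : 'rV[R]_p -> 'rV[R]_p)
  : set 'rV[R]_p := [set y | G y = 0].

(* Parameter sequences are indexed by int because the index -1 is used;
   their values at indices below -1 are never used. *)
Section Coefficients.
Context {R : realType}.
Implicit Types (beta gamma eta : int -> R) (k : int).

Definition theta beta k : R := beta k * (1 - beta (k - 1)) / beta (k - 1).

Definition nu beta gamma eta k : R :=
  beta k / beta (k - 1) + 1 - beta k - eta k / gamma k.

Definition kappa beta gamma eta k : R :=
  beta k / beta (k - 1) * (eta (k - 1) / gamma (k - 1) - 1 + beta (k - 1)).

End Coefficients.

(* Like the parameters, y starts at index -1, whereas x starts at index 0. *)
Definition init (R : realType) (p : nat) (y0 : 'rV[R]_p)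
    (x : nat -> 'rV[R]_p) (y : int -> 'rV[R]_p) : Prop :=
  [/\ y 0 = y0, x 0%N = y0 & y (-1) = y0].

Definition scheme (R : realType) (p : nat) (G : 'rV[R]_p -> 'rV[R]_p)
    (beta gamma eta : int -> R)
    (x : nat -> 'rV[R]_p) (y : int -> 'rV[R]_p) : Prop :=
  forall k : nat,
    x k.+1 = y k%:Z - gamma k%:Z *: G (y k%:Z) /\
    y k.+1%:Z = x k.+1 + theta beta k%:Z *: (x k.+1 - x k)
                + nu beta gamma eta k%:Z *: (y k%:Z - x k.+1)
                + kappa beta gamma eta k%:Z *: (y (k%:Z - 1) - x k).

(* Main.v *)
(* Both schemes are Halpern iterations in disguise: with g k := G (y k),
   y (k+1) = (y0 + (k+1) (y k - (s/L) g k)) / (k+2), where s = 1 in (i) and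
   s = 2 in (ii). Co-coercivity between y k and y (k+1) then makes
     V k := s k(k+1)/(2L) |g k|^2 + (k+1) <g k, y k - y0>
   decrease by at least (1 - s/2) (k+1)(k+2)/L |g (k+1) - g k|^2. Since V 0 = 0,
   co-coercivity between y k and ystar bounds the accumulated decrease plus a
   multiple of |g k|^2 by (k+1) <g k, y0 - ystar>, which is absorbed by Young's
   inequality. *)

Require Import Defs.
From HB Require Import structures.
From mathcomp Require Import all_boot all_order all_algebra.
From mathcomp Require Import all_classical all_reals all_analysis.
From mathcomp Require Import ring lra zify.

Set Implicit Arguments.
Unset Strict Implicit.
Unset Printing Implicit Defensive.

Import Order.TTheory GRing.Theory Num.Theory.
Local Open Scope classical_set_scope.
Local Open Scope ring_scope.

(** * Euclidean inner product and Young's inequality *)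

Section DotProduct.
Context {R : realType} {p : nat}.
Implicit Types (u v w : 'rV[R]_p) (a c : R).

Lemma dotpC u v : dotp u v = dotp v u.
Proof. by apply: eq_bigr => i _; rewrite mulrC. Qed.

Lemma dotpDl u v w : dotp (u + v) w = dotp u w + dotp v w.
Proof. by rewrite -big_split; apply: eq_bigr => i _; rewrite mxE mulrDl. Qed.

Lemma dotpZl a u v : dotp (a *: u) v = a * dotp u v.
Proof. by rewrite /dotp mulr_sumr; apply: eq_bigr => i _; rewrite mxE mulrA. Qed.

Lemma dotpNl u v : dotp (- u) v = - dotp u v.
Proof. by rewrite -scaleN1r dotpZl mulN1r. Qed.

Lemma dotpBl u v w : dotp (u - v) w = dotp u w - dotp v w.
Proof. by rewrite dotpDl dotpNl. Qed.

Lemma dotpDr u v w : dotp u (v + w) = dotp u v + dotp u w.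
Proof. by rewrite dotpC dotpDl !(dotpC u). Qed.

Lemma dotpZr a u v : dotp u (a *: v) = a * dotp u v.
Proof. by rewrite dotpC dotpZl dotpC. Qed.

Lemma dotpBr u v w : dotp u (v - w) = dotp u v - dotp u w.
Proof. by rewrite dotpC dotpBl !(dotpC u). Qed.

Lemma dotp0r u : dotp u 0 = 0.
Proof. by rewrite -(subrr u) dotpBr subrr. Qed.

Lemma dotp_ge0 u : 0 <= dotp u u.
Proof. by apply: sumr_ge0 => i _; rewrite -expr2 sqr_ge0. Qed.

Lemma enorm_ge0 u : 0 <= enorm u.
Proof. exact: sqrtr_ge0. Qed.

Lemma enorm_sqr u : enorm u ^+ 2 = dotp u u.
Proof. by rewrite sqr_sqrtr ?dotp_ge0. Qed.

Lemma young_dotp c u v :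
  2 * c * dotp u v <= c ^+ 2 * dotp u u + dotp v v.
Proof.
have := dotp_ge0 (c *: u - v).
rewrite dotpBl !dotpBr !dotpZl !dotpZr (dotpC v u); lra.
Qed.

(** Young's inequality bounds twice [c * dotp u v]; since that product is at least
    [c ^+ 2 * dotp u u], one copy of the latter cancels. This replaces Cauchy-Schwarz and avoids
    square roots. *)
Lemma dotp_ge_scaled_sqr c u v : 0 <= c ->
  c * dotp u u <= dotp u v -> c ^+ 2 * dotp u u <= dotp v v.
Proof.
move=> c0 cuv; have := young_dotp c u v.
have := ler_wpM2l c0 cuv; lra.
Qed.

End DotProduct.

(** * Closed forms of the coefficients, for a general factor [s] in [eta] *)

Section Coefficients.
Context {R : realType} (L s : R) (beta gamma eta : int -> R).
Hypothesis hL : 0 < L.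
Hypothesis hparam : forall k : int, -1 <= k ->
  [/\ gamma k = 1 / L, beta k = 1 / (k%:~R + 2) & eta k = s * (1 - beta k) / L].

Lemma param_nat (k : nat) :
  [/\ gamma k%:Z = 1 / L, beta k%:Z = 1 / k.+2%:R &
      eta k%:Z = s * (k.+1%:R / k.+2%:R) / L].
Proof.
have [|-> hb ->] := hparam (k := k%:Z); first by lia.
have -> : beta k%:Z = 1 / k.+2%:R by rewrite hb -natrD addn2.
split=> //; congr (s * _ / L); have := ltr0Sn R k.+1; rewrite !mulrS => ?.
by field; rewrite lt0r_neq0.
Qed.

(* At k = 0 the index k - 1 is -1, where beta is 1. *)
Lemma param_pred (k : nat) :
  [/\ gamma (k%:Z - 1) = 1 / L, beta (k%:Z - 1) = 1 / k.+1%:R &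
      eta (k%:Z - 1) = s * (k%:R / k.+1%:R) / L].
Proof.
have [|-> hb ->] := hparam (k := k%:Z - 1); first by lia.
have -> : beta (k%:Z - 1) = 1 / k.+1%:R.
  by rewrite hb rmorphB /= mulrS; congr (1 / _); ring.
split=> //; congr (s * _ / L); have := ltr0Sn R k; rewrite !mulrS => ?.
by field; rewrite lt0r_neq0.
Qed.

(** Since [eta / gamma] is [s * (1 - beta)], both [nu] and [kappa] are affine in [s]: the value 1
    switches off [kappa], the value 2 switches off [nu]. *)
Lemma coefficients (k : nat) :
  [/\ theta beta k%:Z = k%:R / k.+2%:R,
      nu beta gamma eta k%:Z = (2 - s) * (k.+1%:R / k.+2%:R) &
      kappa beta gamma eta k%:Z = (s - 1) * (k%:R / k.+2%:R)].
Proof.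
have [hg hb he] := param_nat k; have [hg' hb' he'] := param_pred k.
rewrite /theta /nu /kappa hg hb he hg' hb' he'.
have L0 : L != 0 by rewrite lt0r_neq0.
have := ltr0Sn R k.+1; have := ltr0Sn R k; rewrite !mulrS.
move=> /lt0r_neq0 k1 /lt0r_neq0 k2.
by split; field; rewrite ?L0 ?k1 ?k2.
Qed.

End Coefficients.

(** * Reduction of the scheme to a Halpern recursion *)

Section Halpern.
Context {R : realType} {p : nat} (L s : R) (G : 'rV[R]_p -> 'rV[R]_p).
Context (ystar y0 : 'rV[R]_p).
Hypotheses (hL : 0 < L) (hG : cocoercive (1 / L) G) (hystar : zer G ystar).

(** Eliminating [x] leaves a three-term recursion for [y], which is the difference of two
    consecutive Halpern relations. The anchor [y0] cancels in that difference, so induction recovers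
    it from the initial step. *)
Lemma scheme_halpern (x : nat -> 'rV[R]_p) (y : int -> 'rV[R]_p)
    (beta gamma eta : int -> R) :
  (forall k : int, -1 <= k ->
    [/\ gamma k = 1 / L, beta k = 1 / (k%:~R + 2) &
        eta k = s * (1 - beta k) / L]) ->
  init y0 x y -> scheme G beta gamma eta x y ->
  forall k : nat, k.+2%:R *: y k.+1%:Z =
    y0 + k.+1%:R *: (y k%:Z - (s / L) *: G (y k%:Z)).
Proof.
move=> hparam [hy0 hx0 hym1] hsch.
have L0 : L != 0 by rewrite lt0r_neq0.
have step k : k.+2%:R *: y k.+1%:Z =
    k.+2%:R *: (y k%:Z - (1 / L) *: G (y k%:Z))
    + k%:R *: (y k%:Z - (1 / L) *: G (y k%:Z) - x k)
    + ((2 - s) * k.+1%:R / L) *: G (y k%:Z)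
    + ((s - 1) * k%:R) *: (y (k%:Z - 1) - x k).
  have [hx ->] := hsch k; rewrite hx.
  have [-> -> ->] := coefficients hL hparam k.
  have [-> _ _] := param_nat hL hparam k.
  have := ltr0Sn R k.+1; rewrite !mulrS => /lt0r_neq0 k2.
  by apply/rowP => i; rewrite !mxE; field; rewrite L0 k2.
elim=> [|k IH].
  rewrite step hx0 hy0; apply/rowP => i; rewrite !mxE; field.
  by rewrite L0.
have [hx _] := hsch k.
have -> : k.+3%:R *: y k.+2%:Z =
    k.+2%:R *: y k.+1%:Z - k.+1%:R *: (y k%:Z - (s / L) *: G (y k%:Z))
    + k.+2%:R *: (y k.+1%:Z - (s / L) *: G (y k.+1%:Z)).
  have [hg _ _] := param_nat hL hparam k.
  rewrite step hx hg.
  have -> : k.+1%:Z - 1 = k%:Z by lia.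
  by apply/rowP => i; rewrite !mxE !mulrS; field; rewrite L0.
by rewrite IH addrK.
Qed.

(** * Energy estimates for the Halpern recursion alone *)

Context (y : nat -> 'rV[R]_p).
Hypotheses (hy0 : y 0%N = y0).
Hypothesis hy : forall k : nat,
  k.+2%:R *: y k.+1 = y0 + k.+1%:R *: (y k - (s / L) *: G (y k)).

Let V (k : nat) : R :=
  s * k%:R * k.+1%:R / (2 * L) * dotp (G (y k)) (G (y k))
  + k.+1%:R * dotp (G (y k)) (y k - y0).

Lemma lyapunov_decrease (k : nat) :
  V k.+1 + (1 - s / 2) / L *
    (k.+1%:R * k.+2%:R * enorm (G (y k.+1) - G (y k)) ^+ 2) <= V k.
Proof.
have L0 : L != 0 by rewrite lt0r_neq0.
have := hG (y k.+1) (y k); rewrite /V enorm_sqr.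
set g' := G (y k.+1); set g := G (y k).
have k1 : 0 < k.+1%:R :> R by rewrite ltr0Sn.
have k2 : 0 < k.+2%:R :> R by rewrite ltr0Sn.
(* The increment is expressed in two ways: through [y k.+1] for pairing with [g'], and through [y k]
   ([e2]) for pairing with [g]. These pairings are the inner products in [V k.+1] and [V k]. *)
have e1 : k.+1%:R *: (y k.+1 - y k) = (y0 - y k.+1) - (s * k.+1%:R / L) *: g.
  apply/rowP => i; have /rowP/(_ i) := hy k.
  rewrite !mxE -/g !mulrS => h.
  apply/eqP; rewrite -subr_eq0; apply/eqP.
  move: h => /eqP; rewrite -subr_eq0 => /eqP h; rewrite -[RHS]h; field.
  by rewrite L0.
have e2 : k.+2%:R *: (y k.+1 - y k) = (y0 - y k) - (s * k.+1%:R / L) *: g.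
  rewrite (mulrS 1 k.+1) scalerDl scale1r e1.
  by apply/rowP => i; rewrite !mxE; ring.
have f1 : k.+1%:R * dotp g' (y k.+1 - y k) =
    - dotp g' (y k.+1 - y0) - s * k.+1%:R / L * dotp g' g.
  by rewrite -dotpZr e1 !dotpBr dotpZr; ring.
have f2 : k.+2%:R * dotp g (y k.+1 - y k) =
    - dotp g (y k - y0) - s * k.+1%:R / L * dotp g g.
  by rewrite -dotpZr e2 !dotpBr dotpZr; ring.
move=> /(ler_wpM2l (ltW (mulr_gt0 k1 k2))).
have -> : k.+1%:R * k.+2%:R * dotp (g' - g) (y k.+1 - y k) =
    k.+2%:R * (k.+1%:R * dotp g' (y k.+1 - y k))
    - k.+1%:R * (k.+2%:R * dotp g (y k.+1 - y k)) by rewrite dotpBl; ring.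
rewrite f1 f2.
rewrite !(dotpBl g') !dotpBr (dotpC g g') -subr_ge0 => h.
(* The two gaps are equal: polarizing [dotp g g'] splits the cross term into the squares needed by
   [V] and a multiple of the squared increment, which lowers its factor from 1 to [1 - s / 2]. *)
rewrite -subr_ge0; apply: le_trans h _; rewrite le_eqVlt; apply/orP; left.
by apply/eqP; rewrite !mulrS; field; rewrite L0.
Qed.

Lemma lyapunov_sum (n : nat) :
  V n + (1 - s / 2) / L * (\sum_(0 <= k < n)
    k.+1%:R * k.+2%:R * enorm (G (y k.+1) - G (y k)) ^+ 2) <= 0.
Proof.
elim: n => [|n IH].
  by rewrite big_geq // /V hy0 subrr dotp0r !(mulr0, mul0r, addr0).
rewrite big_nat_recr //= mulrDr; have := lyapunov_decrease n; lra.
Qed.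

(** Adding [n.+1] times co-coercivity at [y n] and [ystar] to [lyapunov_sum] cancels [y n] from the
    inner products. The coefficient of the squared residual collects one term from [V n] and one
    from co-coercivity. *)
Lemma halpern_bound (n : nat) :
  (s * n%:R / 2 + 1) * n.+1%:R / L * dotp (G (y n)) (G (y n))
  + (1 - s / 2) / L * (\sum_(0 <= k < n)
      k.+1%:R * k.+2%:R * enorm (G (y k.+1) - G (y k)) ^+ 2)
  <= n.+1%:R * dotp (G (y n)) (y0 - ystar).
Proof.
have L0 : L != 0 by rewrite lt0r_neq0.
have := hG (y n) ystar; rewrite hystar subr0 enorm_sqr => co.
have := ler_wpM2l (ler0n R n.+1) co; have := lyapunov_sum n; rewrite /V.
set S := _ / L * \sum_(_ <= _ < _) _.
rewrite !dotpBr; set g2 := dotp (G _) (G _).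
have -> : (s * n%:R / 2 + 1) * n.+1%:R / L * g2 =
   s * n%:R * n.+1%:R / (2 * L) * g2 + n.+1%:R * (1 / L * g2) by field.
lra.
Qed.

Lemma halpern_residual (n : nat) : 0 <= s <= 2 ->
  ((s * n%:R / 2 + 1) / L) ^+ 2 * dotp (G (y n)) (G (y n))
  <= dotp (y0 - ystar) (y0 - ystar).
Proof.
move=> /andP[s0 s2]; apply: dotp_ge_scaled_sqr.
  by rewrite divr_ge0 ?(ltW hL)// addr_ge0// divr_ge0// mulr_ge0.
have n1 : 0 < n.+1%:R :> R by rewrite ltr0Sn.
(* The increment sum is dropped; it has a nonnegative factor because [s <= 2]. *)
rewrite -(ler_pM2l n1); apply: le_trans (halpern_bound n).
rewrite mulrA [_ * (_ / L)]mulrA [_.+1%:R * _]mulrC lerDl mulr_ge0//.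
  by rewrite divr_ge0 ?(ltW hL)// subr_ge0 ler_pdivrMr// mul1r.
by apply: sumr_ge0 => k _; rewrite enorm_sqr !mulr_ge0 ?dotp_ge0.
Qed.

Lemma halpern_increments (n : nat) : 1 <= s ->
  (1 - s / 2) / L * (\sum_(0 <= k < n)
    k.+1%:R * k.+2%:R * enorm (G (y k.+1) - G (y k)) ^+ 2)
  <= L / 2 * dotp (y0 - ystar) (y0 - ystar).
Proof.
move=> s1; have := halpern_bound n; set S := _ / L * \sum_(_ <= _ < _) _.
set g2 := dotp (G _) (G _); set t := dotp _ _; set d2 := dotp _ _ => bound.
pose c := (s * n%:R / 2 + 1) / L.
have cE : c * L = s * n%:R / 2 + 1 by rewrite divfK// lt0r_neq0.
have n0 := ler0n R n.
have c0 : 0 < c by rewrite divr_gt0// ltr_wpDl// divr_ge0 ?mulr_ge0//; lra.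
have d0 : 0 <= d2 by exact: dotp_ge0.
have bound' : c * (n.+1%:R * (c * g2) + S) <= c * (n.+1%:R * t).
  by rewrite ler_pM2l//; apply: le_trans bound; rewrite /c lerD2r; lra.
(* With weight [2 * c], the [g2] term of Young's inequality cancels the one in [bound'] exactly,
   leaving [c * S <= n.+1%:R * d2 / 4]. *)
have young : n.+1%:R * (2 * (2 * c) * t) <= n.+1%:R * ((2 * c) ^+ 2 * g2 + d2).
  by rewrite ler_pM2l ?ltr0Sn// young_dotp.
(* Here [2 * (c * L)] is [s * n + 2], which dominates [n + 1] because [1 <= s]; this makes the final
   bound uniform in [n]. *)
have weak : n.+1%:R * d2 <= 2 * (c * L) * d2.
  by rewrite ler_wpM2r// cE mulrS; nra.
by rewrite -(ler_pM2l c0); lra.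
Qed.

End Halpern.

Theorem corollary1 (R : realType) (p : nat) (L : R)
    (G : 'rV[R]_p -> 'rV[R]_p) (ystar y0 : 'rV[R]_p)
    (hL : 0 < L) (hG : cocoercive (1 / L) G)
    (hzer : zer G !=set0) (hystar : zer G ystar) :
  (* (i) *)
  (forall beta gamma eta : int -> R,
    (forall k : int, -1 <= k ->
      [/\ gamma k = 1 / L,
          beta k = 1 / (k%:~R + 2) &
          eta k = (1 - beta k) / L]) ->
    [/\ (forall k : nat,
          [/\ theta beta k%:Z = k%:R / k.+2%:R,
              nu beta gamma eta k%:Z = k.+1%:R / k.+2%:R &
              kappa beta gamma eta k%:Z = 0]),
        (forall (x : nat -> 'rV[R]_p) (y : int -> 'rV[R]_p),
          scheme G beta gamma eta x y <->
          (forall k : nat,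
            x k.+1 = y k%:Z - (1 / L) *: G (y k%:Z) /\
            y k.+1%:Z = x k.+1 + (k%:R / k.+2%:R) *: (x k.+1 - x k)
                        + (k.+1%:R / k.+2%:R) *: (y k%:Z - x k.+1))) &
        (forall (x : nat -> 'rV[R]_p) (y : int -> 'rV[R]_p),
          init y0 x y -> scheme G beta gamma eta x y ->
          (forall k : nat,
            enorm (G (y k%:Z)) ^+ 2 <=
              4 * L ^+ 2 * enorm (y0 - ystar) ^+ 2 / (k.+1%:R * k.+3%:R)) /\
          (\sum_(0 <= k <oo)
             (k.+1%:R * k.+2%:R *
              enorm (G (y k.+1%:Z) - G (y k%:Z)) ^+ 2)%:E <=
           (2 * L ^+ 2 * enorm (y0 - ystar) ^+ 2)%:E)%E)]) /\
  (* (ii) *)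
  (forall beta gamma eta : int -> R,
    (forall k : int, -1 <= k ->
      [/\ gamma k = 1 / L,
          beta k = 1 / (k%:~R + 2) &
          eta k = 2 * (1 - beta k) / L]) ->
    [/\ (forall k : nat,
          [/\ theta beta k%:Z = k%:R / k.+2%:R,
              nu beta gamma eta k%:Z = 0 &
              kappa beta gamma eta k%:Z = k%:R / k.+2%:R]),
        (forall (x : nat -> 'rV[R]_p) (y : int -> 'rV[R]_p),
          scheme G beta gamma eta x y <->
          (forall k : nat,
            x k.+1 = y k%:Z - (1 / L) *: G (y k%:Z) /\
            y k.+1%:Z = x k.+1 + (k%:R / k.+2%:R) *: (x k.+1 - x k)
                        + (k%:R / k.+2%:R) *: (y (k%:Z - 1) - x k))) &
        (forall (x : nat -> 'rV[R]_p) (y : int -> 'rV[R]_p),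
          init y0 x y -> scheme G beta gamma eta x y ->
          forall k : nat,
            enorm (G (y k%:Z)) <= L * enorm (y0 - ystar) / k.+1%:R)]).
Proof.
have L0 : L != 0 by rewrite lt0r_neq0.
split=> beta gamma eta hparam.
- have hparam1 k : -1 <= k -> [/\ gamma k = 1 / L, beta k = 1 / (k%:~R + 2) &
      eta k = 1 * (1 - beta k) / L] by move/hparam; rewrite !mul1r.
  have hcoef : forall k : nat, [/\ theta beta k%:Z = k%:R / k.+2%:R,
      nu beta gamma eta k%:Z = k.+1%:R / k.+2%:R &
      kappa beta gamma eta k%:Z = 0].
    move=> k; have [-> -> ->] := coefficients hL hparam1 k.
    by split=> //; ring.
  split=> // x y.
    by split=> h k; have := h k; have [-> -> ->] := hcoef k;
      have [-> _ _] := param_nat hL hparam1 k; rewrite scale0r addr0.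
  move=> hinit hsch; have hy := scheme_halpern hL hparam1 hinit hsch.
  have [hy0 _ _] := hinit.
  split=> [k|].
    rewrite !enorm_sqr.
    have := halpern_residual hL hG hystar hy0 hy k.
    rewrite ler01 ler1n => /(_ isT); set g := dotp _ _; set d := dotp _ _.
    have -> : (1 * k%:R / 2 + 1) / L = k.+2%:R / (2 * L).
      by rewrite !mulrS; field.
    rewrite expr_div_n mulrAC ler_pdivrMr; last by rewrite exprn_gt0 ?mulr_gt0.
    have g0 : 0 <= g by exact: dotp_ge0.
    (* [h] carries the factor [(k + 2)^2], which exceeds the required [(k + 1)(k + 3)] by 1. *)
    move=> h; rewrite ler_pdivlMr ?mulr_gt0 ?ltr0Sn //.
    move: h; rewrite !mulrS; have := ler0n R k; nra.
  (* The terms are nonnegative, so the series converges in the extended reals and it suffices to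
     bound every partial sum. *)
  apply: lime_le.
    apply: is_cvg_nneseries => k _ _.
    by rewrite lee_fin enorm_sqr !mulr_ge0 ?dotp_ge0.
  apply: nearW => n; rewrite sumEFin lee_fin enorm_sqr.
  have := halpern_increments hL hG hystar hy0 hy n (lexx 1).
  have := dotp_ge0 (y0 - ystar).
  set d := dotp _ _; set S := \sum_(_ <= _ < _) _ => d0 h.
  (* Clearing the factor [1 / (2 * L)] gives [S <= L ^+ 2 * d], half of the bound claimed. *)
  have : 2 * L * ((1 - 1 / 2) / L * S) <= 2 * L * (L / 2 * d).
    by rewrite ler_pM2l ?mulr_gt0.
  have -> : 2 * L * ((1 - 1 / 2) / L * S) = S by field.
  have := mulr_ge0 (sqr_ge0 L) d0; lra.
- have hcoef : forall k : nat, [/\ theta beta k%:Z = k%:R / k.+2%:R,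
      nu beta gamma eta k%:Z = 0 &
      kappa beta gamma eta k%:Z = k%:R / k.+2%:R].
    move=> k; have [-> -> ->] := coefficients hL hparam k.
    by split=> //; ring.
  split=> // x y.
    by split=> h k; have := h k; have [-> -> ->] := hcoef k;
      have [-> _ _] := param_nat hL hparam k; rewrite scale0r addr0.
  move=> hinit hsch k; have hy := scheme_halpern hL hparam hinit hsch.
  have [hy0 _ _] := hinit.
  have := halpern_residual hL hG hystar hy0 hy k.
  rewrite ler0n lexx => /(_ isT).
  have -> : (2 * k%:R / 2 + 1) / L = k.+1%:R / L by rewrite mulrS; field.
  (* Both sides are squares of nonnegative reals, so the comparison passes to the norms
     themselves. *)
  rewrite -!enorm_sqr -exprMn ler_sqr ?nnegrE ?enorm_ge0 ?mulr_ge0 ?invr_ge0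
    ?(ltW hL) ?enorm_ge0 // mulrAC ler_pdivrMr// ler_pdivlMr ?ltr0Sn//.
  by rewrite mulrC [L * _]mulrC.
Qed.
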